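(* Consider the projected stochastic heavy-ball SQP method under the assumptions stated in the context. Define $$\tau := \frac{\sigma_{\min}\rho_{\min}}{\sigma_{\min}\rho_{\min} + \kappa_{\nabla f}\rho_{\max}},$$ so that $1 - \frac{\tau \kappa_{\nabla f}\rho_{\max}}{\sigma_{\min}\rho_{\min}} = \tau$, and, with this $\tau$, let $$C := \frac{\beta L_{P\nabla f} \tau}{1-\beta} \left( \frac{\rho_{\max}^2 \kappa_c^2 }{2\sigma_{\min}^2} + \frac{\kappa_{\nabla f}^2 + M^2}{ h_{\min}^2 (1-\beta)^2}\right) + \frac12 (\tau L_{\nabla f} + L_J) \left( \frac{\rho_{\max}^2 \kappa_c^2}{\sigma_{\min}^2} + \frac{\kappa_{\nabla f}^2 + M^2}{h_{\min}^2 (1-\beta)^2} \right).$$ Then, for every positive integer $K$, $$\frac{1}{K} \sum_{k=1}^K \mathbb{E}\left[ h_{\max}^{-1} \|P_k \nabla f(x_k) \|_2^2 + \rho_{\min} \|c_k\|_1 \right] \leq \frac{\phi(x_1,\tau) - \tau f_{\inf}}{\alpha \tau K} + \frac{\alpha C}{\tau}.$$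
   Context: Problem. Consider $\min_{x\in\mathbb{R}^n} f(x)$ subject to $c(x)=0$, where $f:\mathbb{R}^n\to\mathbb{R}$ (with $f(x)=\mathbb{E}_\xi[F(x,\xi)]$ for a random variable $\xi$) and $c:\mathbb{R}^n\to\mathbb{R}^m$. Write $J(x)\in\mathbb{R}^{m\times n}$ for the Jacobian of $c$ at $x$ (i.e. $J=\nabla c^T$) and $P(x) := I - J(x)^T(J(x)J(x)^T)^{-1}J(x)$. Write $c_k:=c(x_k)$, $J_k:=J(x_k)$, $P_k:=P(x_k)$. For $\tau>0$ let $\phi(x,\tau):=\tau f(x)+\|c(x)\|_1$. Algorithm (projected stochastic heavy-ball SQP). Inputs: initial point $x_1\in\mathbb{R}^n$, prescribed sequences $\{\rho_k\}\subset(0,1]$ and $\{h_k\}\subset\mathbb{R}_{>0}$, $\beta\in[0,1)$, $\alpha\in(0,1]$. Set $r_0=0\in\mathbb{R}^n$. For $k=1,2,\dots$: obtain a stochastic gradient estimate $g_k\in\mathbb{R}^n$ of $\nabla f(x_k)$; set $v_k = -\rho_k J_k^T(J_kJ_k^T)^{-1}c_k$, $u_k=-h_k^{-1}P_kg_k$, $r_k=\beta r_{k-1}+u_k$, $d_k=v_k+P_kr_k$, $x_{k+1}=x_k+\alpha d_k$. Probability. The only randomness is in the gradient estimates, and $\mathbb{E}$ is expectation on the underlying probability space. $\mathcal{F}_1$ is the $\sigma$-algebra defined by the (given) initial conditions, and $\mathcal{F}_k$ is the $\sigma$-algebra generated by the initial conditions and the stochastic gradient estimators $g_1,\dots,g_{k-1}$;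 $\{\mathcal{F}_k\}$ is a filtration. Assumptions. There is an open convex set $\mathcal{X}\subseteq\mathbb{R}^n$ containing all iterates of any run of the algorithm, over which $f$ is continuously differentiable and bounded below by $f_{\inf}\in\mathbb{R}$, and over which $c$ is continuously differentiable with $\|c(x)\|_2\le\kappa_c$ for all $x\in\mathcal{X}$, for some $\kappa_c>0$. There are positive constants $\kappa_{\nabla f},\kappa_J,L_{\nabla f},\hat L_J,\sigma_{\min}$ such that for all $x,\bar x\in\mathcal{X}$: $\|\nabla f(x)\|_2\le\kappa_{\nabla f}$; $\|J(x)\|_2\le\kappa_J$; $\|\nabla f(x)-\nabla f(\bar x)\|_2\le L_{\nabla f}\|x-\bar x\|_2$; $\|J(x)-J(\bar x)\|_2\le\hat L_J\|x-\bar x\|_2$; and the smallest singular value of $J(x)$ is at least $\sigma_{\min}$ (with $m\le n$, so $J(x)$ has full row rank). For all $k\ge1$, $\mathbb{E}[P_kg_k|\mathcal{F}_k]=P_k\nabla f(x_k)$, and there is a constant $M\in\mathbb{R}$ with $\mathbb{E}[\|P_k(g_k-\nabla f(x_k))\|_2^2|\mathcal{F}_k]\le M^2$ for all $k\ge 1$. There are $\rho_{\min},\rho_{\max}\in(0,1]$ and $h_{\min},h_{\max}>0$ with $\rho_{\min}\le\rho_k\le\rho_{\max}$ and $h_{\min}\le h_k\le h_{\max}$ for all $k\ge 1$. Derived constants (which exist under these assumptions). $L_J>0$ is a constant with $\|c(\bar x)\|_1\le\|c(x)+J(x)(\bar x-x)\|_1+\frac12L_J\|\bar x-x\|_2^2$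 for all $x,\bar x\in\mathcal{X}$, and $L_{P\nabla f}>0$ is a constant with $\|P(x)\nabla f(x)-P(\bar x)\nabla f(\bar x)\|_2\le L_{P\nabla f}\|x-\bar x\|_2$ for all $x,\bar x\in\mathcal{X}$. *)

(* Defs.v *)
From mathcomp Require Export all_boot all_order all_algebra.
From mathcomp Require Export all_classical all_reals all_analysis.

Set Implicit Arguments.
Unset Strict Implicit.
Unset Printing Implicit Defensive.

Export Order.TTheory GRing.Theory Num.Theory.
Export numFieldNormedType.Exports.

Local Open Scope classical_set_scope.
Local Open Scope ring_scope.

(* Vectors of R^n are columns.  The library's norm on matrices is the max norm,
   so the Euclidean, l1 and spectral norms are defined here. *)
Definition norm2 (R : realType) (n : nat) (v : 'cV[R]_n) : R :=
  Num.sqrt (\sum_(i < n) v i 0 ^+ 2).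

Definition norm1 (R : realType) (n : nat) (v : 'cV[R]_n) : R :=
  \sum_(i < n) `|v i 0|.

Definition spectral_norm (R : realType) (m n : nat) (A : 'M[R]_(m, n)) : R :=
  sup [set norm2 (A *m v) | v in [set v : 'cV[R]_n | norm2 v <= 1]].

(* For m <= n, the m singular values of A are the square roots of the
   eigenvalues of the m x m Gram matrix A A^T. *)
Definition singular_value (R : realType) (m n : nat) (A : 'M[R]_(m, n)) (s : R) :=
  0 <= s /\ eigenvalue (A *m A^T) (s ^+ 2).

(* The set is finite, and nonempty when 0 < m, so the infimum is then a minimum. *)
Definition smallest_singular_value (R : realType) (m n : nat)
    (A : 'M[R]_(m, n)) : R :=
  inf [set s | singular_value A s].

Definition grad (R : realType) (n : nat) (f : 'cV[R]_n -> R) (x : 'cV[R]_n) :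
    'cV[R]_n :=
  \col_(i < n) 'D_(delta_mx i 0) f x.

(* The transpose of the library's [jacobian], which is for row vectors. *)
Definition Jac (R : realType) (m n : nat) (c : 'cV[R]_n -> 'cV[R]_m)
    (x : 'cV[R]_n) : 'M[R]_(m, n) :=
  \matrix_(i < m, j < n) 'D_(delta_mx j 0) (fun y => c y i 0) x.

(* x |-> I - J^T (J J^T)^-1 J *)
Definition projector (R : realType) (m n : nat) (c : 'cV[R]_n -> 'cV[R]_m)
    (x : 'cV[R]_n) : 'M[R]_n :=
  1%:M - (Jac c x)^T *m invmx (Jac c x *m (Jac c x)^T) *m Jac c x.

Definition merit (R : realType) (m n : nat) (f : 'cV[R]_n -> R)
    (c : 'cV[R]_n -> 'cV[R]_m) (x : 'cV[R]_n) (tau : R) : R :=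
  tau * f x + norm1 (c x).

(* One realization of the algorithm, driven by the gradient estimates g_1, g_2, ...
   The values x 0, g 0, v 0, u 0 and d 0 are irrelevant. *)
Definition heavy_ball_sqp_run (R : realType) (m n : nat)
    (c : 'cV[R]_n -> 'cV[R]_m) (x1 : 'cV[R]_n) (rho h : nat -> R)
    (beta alpha : R) (g x v u r d : nat -> 'cV[R]_n) : Prop :=
  [/\ x 1%N = x1,
      r 0%N = 0 &
      forall k : nat, (1 <= k)%N ->
        let J := Jac c (x k) in
        let P := projector c (x k) in
        [/\ v k = - (rho k *: (J^T *m invmx (J *m J^T) *m c (x k))),
            u k = - ((h k)^-1 *: (P *m g k)),
            r k = beta *: r k.-1 + u k,
            d k = v k + P *m r k &
            x k.+1 = x k + alpha *: d k]].

(* F_k: the sigma-algebra generated by g_1, ..., g_(k-1); the initial conditions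
   are deterministic and contribute nothing. *)
Definition gradient_filtration (R : realType) (n : nat) (T : Type)
    (g : nat -> T -> 'cV[R]_n) (k : nat) : set (set T) :=
  <<s \bigcup_(j in [set j | (1 <= j < k)%N]) \bigcup_(i in [set: 'I_n])
        preimage_set_system setT (fun w => g j w i 0) measurable >>.

(* Y is a version of the conditional expectation E[X | G]. *)
Definition is_cond_expectation (dT : measure_display) (T : measurableType dT)
    (R : realType) (P : probability T R) (G : set (set T)) (X Y : T -> R) : Prop :=
  [/\ P.-integrable setT (EFin \o X),
      P.-integrable setT (EFin \o Y),
      (forall B, measurable B -> G (Y @^-1` B)) &
      forall A, G A ->
        (\int[P]_(w in A) (X w)%:E = \int[P]_(w in A) (Y w)%:E)%E].

(* Main.v *)
Require Import Defs.
From mathcomp Require Import measurable_realfun.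
From mathcomp Require Import ring lra.

(** Write c_k, P_k, f'_k for the constraint value, the projector and the gradient
    at x_k, and G_k := P_k f'_k.  The normal step v_k lies in the row space of
    J_k and the tangential step P_k r_k in its kernel, so that
    |d_k|^2 <= V + |r_k|^2 with V := rho_max^2 kappa_c^2 / sigma_min^2, while
    c_k + alpha J_k d_k = (1 - alpha rho_k) c_k.  Together with the descent
    inequalities for f and for |c|_1, and with tau chosen so that the increase of
    tau f along v_k is absorbed by the decrease of |c|_1 up to the factor tau,
    this gives along every run ([merit_decrease])

      phi_(k+1) <= phi_k + alpha tau G_k.r_k - alpha tau rho_min |c_k|_1
                   + (tau L_f + L_J) / 2 * alpha^2 (V + |r_k|^2).

    It remains to estimate two expectations.  As P_k g_k is unbiased with
    variance at most M^2, its second moment is at most kappa_f^2 + M^2, and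
    convexity of the squared norm propagates through r_k = beta r_(k-1) + u_k
    to E|r_k|^2 <= B := (kappa_f^2 + M^2) / (h_min (1 - beta))^2
    ([Ex_momentum_sq]).  For a_k := E[G_k.r_k], taking the known vector G_k out
    of the conditional expectation gives
    a_k = beta E[G_k.r_(k-1)] - E|G_k|^2 / h_k, and by Lipschitz continuity of
    the projected gradient E[G_k.r_(k-1)] exceeds a_(k-1) by at most
    alpha L_Pf (V / 2 + B).  Hence, by induction,
    a_k <= beta alpha L_Pf (V / 2 + B) / (1 - beta) - E|G_k|^2 / h_max
    ([Ex_gradient_momentum_descent]).  Summing the pathwise inequality over k
    and taking expectations yields the bound.

    No measurability of x_k or of c(x_k) is needed: the pathwise inequality is
    summed first, and the integral of nonnegative functions, being a supremum
    over simple functions, is superadditive for arbitrary functions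
    ([ge0_lower_integral_sum]); the majorant of the sum involves only G_k and
    r_k, which are measurable by the hypotheses on the estimates. *)

Set Implicit Arguments.
Unset Strict Implicit.
Unset Printing Implicit Defensive.

Local Open Scope classical_set_scope.
Local Open Scope ring_scope.

(** * Euclidean geometry of column vectors *)

(** The Euclidean inner product of column vectors. *)
Definition dot (R : realType) (n : nat) (u v : 'cV[R]_n) : R := (u^T *m v) 0 0.

Section Dot.
Context (R : realType).
Implicit Types n m : nat.

Lemma dotE n (u v : 'cV[R]_n) : dot u v = \sum_(i < n) u i 0 * v i 0.
Proof. by rewrite /dot mxE; apply: eq_bigr => i _; rewrite mxE. Qed.

Lemma dotC n (u v : 'cV[R]_n) : dot u v = dot v u.
Proof. by rewrite !dotE; apply: eq_bigr => i _; rewrite mulrC. Qed.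

Lemma dotDr n (u v w : 'cV[R]_n) : dot u (v + w) = dot u v + dot u w.
Proof. by rewrite /dot mulmxDr mxE. Qed.

Lemma dotZr n a (u v : 'cV[R]_n) : dot u (a *: v) = a * dot u v.
Proof. by rewrite /dot -scalemxAr mxE. Qed.

Lemma dotNr n (u v : 'cV[R]_n) : dot u (- v) = - dot u v.
Proof. by rewrite -scaleN1r dotZr mulN1r. Qed.

Lemma dotBr n (u v w : 'cV[R]_n) : dot u (v - w) = dot u v - dot u w.
Proof. by rewrite dotDr dotNr. Qed.

Lemma dotDl n (u v w : 'cV[R]_n) : dot (u + v) w = dot u w + dot v w.
Proof. by rewrite dotC dotDr !(dotC w). Qed.

Lemma dotZl n a (u v : 'cV[R]_n) : dot (a *: u) v = a * dot u v.
Proof. by rewrite dotC dotZr dotC. Qed.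

Lemma dotNl n (u v : 'cV[R]_n) : dot (- u) v = - dot u v.
Proof. by rewrite dotC dotNr dotC. Qed.

Lemma dotBl n (u v w : 'cV[R]_n) : dot (u - v) w = dot u w - dot v w.
Proof. by rewrite dotDl dotNl. Qed.

Lemma dot_mulmxr m n (A : 'M[R]_(m, n)) u v : dot u (A *m v) = dot (A^T *m u) v.
Proof. by rewrite /dot trmx_mul trmxK mulmxA. Qed.

Lemma dot_ge0 n (u : 'cV[R]_n) : 0 <= dot u u.
Proof. by rewrite dotE; apply: sumr_ge0 => i _; rewrite -expr2 sqr_ge0. Qed.

Lemma sqr_norm2 n (u : 'cV[R]_n) : norm2 u ^+ 2 = dot u u.
Proof.
rewrite sqr_sqrtr; last by apply: sumr_ge0 => i _; rewrite sqr_ge0.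
by rewrite dotE; apply: eq_bigr => i _; rewrite expr2.
Qed.

Lemma norm2_ge0 n (u : 'cV[R]_n) : 0 <= norm2 u.
Proof. exact: sqrtr_ge0. Qed.

Lemma norm1_ge0 n (u : 'cV[R]_n) : 0 <= norm1 u.
Proof. exact: sumr_ge0. Qed.

Lemma norm2_le n m (u : 'cV[R]_n) (v : 'cV[R]_m) :
  (norm2 u <= norm2 v) = (dot u u <= dot v v).
Proof. by rewrite -!sqr_norm2 ler_sqr ?nnegrE ?norm2_ge0. Qed.

Lemma norm2Z n a (u : 'cV[R]_n) : norm2 (a *: u) = `|a| * norm2 u.
Proof.
have au0 : 0 <= `|a| * norm2 u by rewrite mulr_ge0 ?norm2_ge0.
apply/eqP; rewrite -(eqrXn2 (_ : 0 < 2)%N (norm2_ge0 _) au0)//; apply/eqP.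
by rewrite exprMn !sqr_norm2 dotZl dotZr real_normK ?num_real// mulrA.
Qed.

Lemma norm2N n (u : 'cV[R]_n) : norm2 (- u) = norm2 u.
Proof. by rewrite -scaleN1r norm2Z normrN1 mul1r. Qed.

Lemma norm1Z n a (u : 'cV[R]_n) : norm1 (a *: u) = `|a| * norm1 u.
Proof.
by rewrite /norm1 mulr_sumr; apply: eq_bigr => i _; rewrite mxE normrM.
Qed.

Lemma dot_eq0 n (u : 'cV[R]_n) : (dot u u == 0) = (u == 0).
Proof.
apply/idP/eqP => [|->]; last by rewrite /dot mulmx0 mxE.
rewrite dotE psumr_eq0 => [/allP u0|i _]; last by rewrite -expr2 sqr_ge0.
apply/colP => i; have := u0 i (mem_index_enum i).
by rewrite mulf_eq0 orbb mxE => /eqP.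
Qed.

Lemma norm2_le_norm1 n (u : 'cV[R]_n) : norm2 u <= norm1 u.
Proof.
rewrite -ler_sqr ?nnegrE ?norm2_ge0 ?norm1_ge0// sqr_norm2 dotE expr2.
rewrite {1}/norm1 mulr_suml; apply: ler_sum => i _.
rewrite (le_trans (ler_norm _))// normrM ler_wpM2l//.
by rewrite /norm1 (bigD1 i)//= lerDl sumr_ge0.
Qed.

(** No sign is assumed for the leading coefficient c, which may also vanish. *)
Lemma quadratic_ge0_discr (a b c : R) :
  (forall t, 0 <= a + 2 * b * t + c * t ^+ 2) -> b ^+ 2 <= a * c.
Proof.
move=> h; have a0 : 0 <= a by have := h 0; rewrite mulr0 expr0n/= mulr0 !addr0.
have [c0|c0|c0] := ltgtP c 0.
- (* For large t the term c t^2 dominates. *)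
  have [t [t0 tP]] : exists t, 0 < t /\ a + 2 * b * t + c * t ^+ 2 < 0.
    exists ((2 * `|b| + a + 1) / - c + 1); set t := _ + 1.
    have tc : - c * t >= 2 * `|b| + a + 1.
      rewrite /t mulrDr mulr1 [X in _ <= X + _]mulrC divfK ?oppr_eq0 ?lt_eqF//.
      by rewrite lerDl; lra.
    have t1 : 1 <= t.
      by rewrite /t lerDr divr_ge0//; [have := normr_ge0 b|]; lra.
    split; first lra.
    have := ler_norm b => bb.
    have : 2 * b * t <= 2 * `|b| * t by nra.
    have : - c * t * t >= (2 * `|b| + a + 1) * t by nra.
    nra.
  by have := h t; lra.
- (* The minimum is attained at t = - b / c. *)
  have := h (- b / c).
  rewrite (_ : _ + _ = (a * c - b ^+ 2) / c); last by field; rewrite gt_eqF.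
  by rewrite pmulr_lge0 ?invr_gt0// subr_ge0.
- have [->|b0] := eqVneq b 0; first by rewrite expr0n c0 mulr0.
  (* The polynomial is affine and takes the value -1 at this point. *)
  have := h (- (a + 1) / (2 * b)); rewrite c0 mul0r addr0 mulrC divfK; last first.
    by rewrite mulf_neq0.
  lra.
Qed.

(** The Cauchy-Schwarz inequality for a positive semidefinite form. *)
Lemma psd_cauchy_schwarz n (B : 'M[R]_n) (u v : 'cV[R]_n) :
  B^T = B -> (forall w : 'cV[R]_n, 0 <= dot w (B *m w)) ->
  dot u (B *m v) ^+ 2 <= dot u (B *m u) * dot v (B *m v).
Proof.
move=> Bsym Bpsd; apply: quadratic_ge0_discr => t.
have := Bpsd (u + t *: v).
rewrite mulmxDr -scalemxAr dotDl !dotDr !dotZl !dotZr.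
have -> : dot v (B *m u) = dot u (B *m v) by rewrite dotC [RHS]dot_mulmxr Bsym.
by move/le_trans; apply; rewrite le_eqVlt; apply/orP; left; apply/eqP; ring.
Qed.

Lemma cauchy_schwarz n (u v : 'cV[R]_n) : `|dot u v| <= norm2 u * norm2 v.
Proof.
rewrite -ler_sqr ?nnegrE ?mulr_ge0 ?norm2_ge0// exprMn !sqr_norm2.
rewrite real_normK ?num_real//.
have := @psd_cauchy_schwarz n 1%:M u v (trmx1 _ _).
by rewrite !mul1mx; apply => w; rewrite mul1mx dot_ge0.
Qed.

Lemma quadratic_form_le n (C : 'M[R]_n) (v : 'cV[R]_n) :
  dot v (C *m v) <= (\sum_i \sum_j `|C i j|) * dot v v.
Proof.
rewrite dotE mulr_suml; apply: ler_sum => i _.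
rewrite mxE mulr_sumr mulr_suml; apply: ler_sum => j _.
rewrite (le_trans (ler_norm _))// normrM normrM mulrCA ler_wpM2l//.
have vle k : v k 0 ^+ 2 <= dot v v.
  rewrite dotE (bigD1 k)//= expr2 lerDl; apply: sumr_ge0 => l _.
  by rewrite -expr2 sqr_ge0.
have := vle i; have := vle j.
rewrite -(real_normK (num_real (v i 0))) -(real_normK (num_real (v j 0))).
by move: `|v i 0| `|v j 0| => a b; have := sqr_ge0 (a - b); nra.
Qed.

End Dot.

(** * The smallest singular value *)

Section SingularValue.
Context (R : realType).

(** A lower bound on the eigenvalues of a symmetric matrix bounds its Rayleigh
    quotients.  The infimum l of the Rayleigh quotients is an eigenvalue:
    otherwise B := A - l I would be positive semidefinite and invertible, and
    Cauchy-Schwarz for B gives |v|^4 <= (v^T B v) (v^T B^-1 v), which bounds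
    v^T B v away from 0 on the unit sphere. *)
Lemma eigenvalue_le_quadratic n (A : 'M[R]_n) (mu : R) :
  A^T = A -> (forall a, eigenvalue A a -> mu <= a) ->
  forall v : 'cV[R]_n, mu * dot v v <= dot v (A *m v).
Proof.
move=> Asym Amu v.
have [->|v0] := eqVneq v 0; first by rewrite mulmx0 /dot !mulmx0 mxE mulr0.
pose q (w : 'cV[R]_n) := dot w (A *m w) / dot w w.
pose S := [set q w | w in [set w | w != 0]].
have dpos (w : 'cV[R]_n) : w != 0 -> 0 < dot w w.
  by move=> w0; rewrite lt_neqAle dot_ge0 eq_sym dot_eq0 w0.
have S0 : S !=set0 by exists (q v), v.
have Slb : has_lbound S.
  exists (- \sum_i \sum_j `|(- A) i j|) => _ [w w0 <-].
  rewrite ler_pdivlMr ?dpos// mulNr lerNl -dotNr -mulNmx.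
  exact: quadratic_form_le.
pose l := inf S.
have lA w : l * dot w w <= dot w (A *m w).
  have [->|w0] := eqVneq w 0; first by rewrite mulmx0 /dot !mulmx0 mxE mulr0.
  by rewrite -ler_pdivlMr ?dpos//; apply: ge_inf => //; exists w.
suff /Amu mul : eigenvalue A l.
  by rewrite (le_trans _ (lA v))// ler_wpM2r ?dot_ge0.
rewrite /eigenvalue /eigenspace kermx_eq0 row_free_unit.
set B := A - l%:M; apply/negP => Bu.
have Bw w : B *m w = A *m w - l *: w by rewrite mulmxBl mul_scalar_mx.
have Bsym : B^T = B by rewrite /B linearB/= tr_scalar_mx Asym.
have Bpsd (w : 'cV[R]_n) : 0 <= dot w (B *m w).
  by rewrite Bw dotBr dotZr subr_ge0.
pose K := \sum_i \sum_j `|invmx B i j| + 1.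
have K0 : 0 < K by rewrite ltr_pwDr// !sumr_ge0// => i _; rewrite sumr_ge0.
have coercive w : w != 0 -> l + K^-1 <= q w.
  move=> w0; have w2 := dpos _ w0.
  have := @psd_cauchy_schwarz R n B w (invmx B *m w) Bsym Bpsd.
  rewrite mulmxA mulmxV// mul1mx (dotC (invmx B *m w)) => CS.
  have {}CS : dot w w ^+ 2 <= dot w (B *m w) * (K * dot w w).
    apply: le_trans CS _; apply: ler_wpM2l => //.
    apply: le_trans (quadratic_form_le _ _) _.
    by rewrite ler_wpM2r ?dot_ge0// lerDl.
  move: CS; rewrite mulrA expr2 ler_pM2r// -ler_pdivrMr//.
  rewrite Bw dotBr dotZr lerBrDl => h.
  by rewrite ler_pdivlMr// mulrDl (mulrC K^-1).
have : l + K^-1 <= inf S.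
  by apply: lb_le_inf => // _ [w w0 <-]; exact: coercive.
by rewrite -/l gerDl leNgt invr_gt0 K0.
Qed.

Section FullRowRank.
Context (m n : nat) (J : 'M[R]_(m, n)) (s : R).
Hypothesis s_gt0 : 0 < s.
Hypothesis s_le : s <= smallest_singular_value J.

Lemma smallest_singular_value_le (v : 'cV[R]_m) :
  s * norm2 v <= norm2 (J^T *m v).
Proof.
have s0 := ltW s_gt0.
rewrite -ler_sqr ?nnegrE ?mulr_ge0 ?norm2_ge0// exprMn !sqr_norm2.
rewrite -[X in _ <= X]dot_mulmxr mulmxA.
apply: eigenvalue_le_quadratic => [|a]; first by rewrite trmx_mul trmxK.
move=> ea; have [w wa w0] := eigenvalueP ea.
(* As w J J^T = a w, the squared norm of w J is a |w|^2. *)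
have a0 : 0 <= a.
  have : 0 <= dot (w *m J)^T (w *m J)^T by exact: dot_ge0.
  rewrite /dot trmxK trmx_mul mulmxA -(mulmxA w) wa -scalemxAl mxE.
  have := dot_ge0 w^T; rewrite le_eqVlt eq_sym dot_eq0 trmx_eq0 (negbTE w0)/=.
  by rewrite /dot trmxK => w2; rewrite pmulr_lge0.
have : s <= Num.sqrt a.
  apply: le_trans s_le _; apply: ge_inf; first by exists 0 => t [].
  by split; [exact: sqrtr_ge0|rewrite sqr_sqrtr].
by rewrite -ler_sqr ?nnegrE ?sqrtr_ge0// sqr_sqrtr.
Qed.

Lemma gram_unitmx : J *m J^T \in unitmx.
Proof.
rewrite -row_free_unit -kermx_eq0; apply/eqP/row_matrixP => i; rewrite row0.
set w := row i _; have : w *m (J *m J^T) = 0.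
  by apply/sub_kermxP; exact: row_sub.
move=> w0; apply/eqP; rewrite -trmx_eq0 -dot_eq0 -sqr_norm2 sqrf_eq0.
rewrite eq_le norm2_ge0 andbT -(pmulr_rle0 _ s_gt0).
apply: le_trans (smallest_singular_value_le _) _.
suff -> : J^T *m w^T = 0 by rewrite /norm2 big1 ?sqrtr0// => j _; rewrite mxE expr0n.
apply/eqP; rewrite -dot_eq0 -dot_mulmxr mulmxA /dot trmxK mulmxA w0 mul0mx.
by rewrite mxE.
Qed.

(** The least-norm solution of J v = c has norm at most |c| / sigma_min(J). *)
Lemma norm2_least_norm_solution (c : 'cV[R]_m) :
  norm2 (J^T *m invmx (J *m J^T) *m c) <= norm2 c / s.
Proof.
rewrite -mulmxA; set w := _ *m c.
have [->|Jw0] := eqVneq (norm2 (J^T *m w)) 0.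
  by rewrite divr_ge0 ?norm2_ge0// ltW.
have {Jw0} : 0 < norm2 (J^T *m w) by rewrite lt_neqAle eq_sym Jw0 norm2_ge0.
move=> Jw; rewrite ler_pdivlMr//.
have : norm2 (J^T *m w) ^+ 2 <= norm2 c * norm2 w.
  rewrite sqr_norm2 -dot_mulmxr mulmxA mulmxA mulmxV ?gram_unitmx// mul1mx.
  by rewrite dotC (le_trans (ler_norm _))// cauchy_schwarz.
have := smallest_singular_value_le w; have := norm2_ge0 c.
move: (norm2 (J^T *m w)) (norm2 c) (norm2 w) Jw => x y z Jw y0 szx xyz.
rewrite -(ler_pM2l Jw); apply: (@le_trans _ _ (s * (y * z))); last by nra.
by rewrite (_ : x * _ = s * x ^+ 2) ?ler_pM2l//; ring.
Qed.

End FullRowRank.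
End SingularValue.

(** * Projection onto the null space of the Jacobian *)

(** The orthogonal projector onto the kernel of J, when J has full row rank. *)
Definition kernel_projector (R : realType) (m n : nat) (J : 'M[R]_(m, n)) :
    'M[R]_n :=
  1%:M - J^T *m invmx (J *m J^T) *m J.

Section KernelProjector.
Context (R : realType) (m n : nat) (J : 'M[R]_(m, n)).
Hypothesis J_unit : J *m J^T \in unitmx.
Local Notation P := (kernel_projector J).

Lemma kernel_projector_sym : P^T = P.
Proof.
rewrite /kernel_projector linearB/= trmx1 !trmx_mul trmxK trmx_inv trmx_mul.
by rewrite trmxK mulmxA.
Qed.

Lemma mulmx_kernel_projector : J *m P = 0.
Proof.
by rewrite mulmxBr mulmx1 !mulmxA mulmxV// mul1mx subrr.
Qed.

Lemma kernel_projector_idem : P *m P = P.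
Proof.
rewrite [X in X *m _]/kernel_projector mulmxBl mul1mx.
by rewrite -(mulmxA _ J) mulmx_kernel_projector mulmx0 subr0.
Qed.

Lemma dot_kernel_projector (u v : 'cV[R]_n) : dot u (P *m v) = dot (P *m u) v.
Proof. by rewrite dot_mulmxr kernel_projector_sym. Qed.

Lemma norm2_kernel_projector (v : 'cV[R]_n) : norm2 (P *m v) <= norm2 v.
Proof.
rewrite norm2_le; have := dot_ge0 (v - P *m v).
rewrite dotBl !dotBr (dotC (P *m v) v) [dot v (P *m v)]dot_kernel_projector.
have -> : dot (P *m v) v = dot (P *m v) (P *m v).
  by rewrite dot_kernel_projector mulmxA kernel_projector_idem.
lra.
Qed.

(** Row-space vectors are orthogonal to projected ones, which gives the
    Pythagorean identity for the sum of a normal and a tangential step. *)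
Lemma dot_normal_tangential (c : 'cV[R]_m) (v : 'cV[R]_n) :
  dot (J^T *m c) (P *m v) = 0.
Proof.
by rewrite dotC dot_mulmxr trmxK mulmxA mulmx_kernel_projector mul0mx /dot
  trmx0 mul0mx mxE.
Qed.

End KernelProjector.

(** * Descent lemma for functions with Lipschitz gradient *)

Section Descent.
Context (R : realType) (n : nat).
Implicit Types (f : 'cV[R]_n -> R) (X : set 'cV[R]_n).

Lemma derive_grad f x v : differentiable f x -> 'D_v f x = dot (grad f x) v.
Proof.
move=> df; rewrite deriveE// dotE.
have -> : 'd f x v = 'd f x (\sum_i v i 0 *: delta_mx i 0).
  congr ('d f x _); rewrite {1}[v]matrix_sum_delta; apply: eq_bigr => i _.
  by rewrite big_ord1.
rewrite linear_sum; apply: eq_bigr => i _.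
by rewrite linearZ/= mxE deriveE// mulrC.
Qed.

Lemma convex_set_segment X (y z : 'cV[R]_n) (t : R) : convex_set X -> X y -> X z ->
  0 <= t <= 1 -> X (y + t *: (z - y)).
Proof.
move=> Xc Xy Xz /andP[t0 t1].
have := Xc z y (Itv01 t0 t1); rewrite !inE => /(_ Xz Xy).
suff -> : y + t *: (z - y) = t *: z + (1 - t) *: y by [].
by rewrite scalerBl scale1r scalerBr addrCA addrA addrAC.
Qed.

Lemma is_derive_segment f (y v : 'cV[R]_n) (t : R) : differentiable f (y + t *: v) ->
  is_derive t 1 (fun s : R => f (y + s *: v)) (dot (grad f (y + t *: v)) v).
Proof.
move=> df; have dv := @diff_derivable _ _ _ f _ v df.
have E : (fun h : R => h^-1 *: (((fun s => f (y + s *: v)) \o shift t) (h *: 1)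
      - f (y + t *: v))) =
    (fun h => h^-1 *: ((f \o shift (y + t *: v)) (h *: v) - f (y + t *: v))).
  by apply/funext => h /=; rewrite [h *: 1]mulr1 scalerDl addrCA.
apply: DeriveDef; first by rewrite /derivable E.
by rewrite -derive_grad// /derive E.
Qed.

Lemma descent_lemma f X (L : R) (y z : 'cV[R]_n) : convex_set X ->
  (forall x, X x -> differentiable f x) ->
  (forall x x', X x -> X x' -> norm2 (grad f x - grad f x') <= L * norm2 (x - x')) ->
  X y -> X z ->
  f z <= f y + dot (grad f y) (z - y) + 2^-1 * L * norm2 (z - y) ^+ 2.
Proof.
move=> Xc df lip Xy Xz; set v := z - y.
pose a := dot (grad f y) v; pose b := 2^-1 * L * norm2 v ^+ 2.
(* By the Lipschitz bound psi has a nonpositive derivative on [0, 1]; the claim is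
   psi 1 <= psi 0. *)
pose psi : R -> R :=
  (fun t => f (y + t *: v)) - a *: (id : R -> R) - b *: (id : R -> R) ^+ 2.
pose dpsi (t : R) := dot (grad f (y + t *: v)) v - a - b * (2 * t).
have Xt (t : R) : 0 <= t <= 1 -> X (y + t *: v) by exact: convex_set_segment.
have psiD (t : R) : t \in `[0, 1] -> is_derive t 1 psi (dpsi t).
  rewrite in_itv/= => /Xt/df/is_derive_segment dft.
  apply: is_derive_eq; rewrite /dpsi -[a *: 1]/(a * 1) mulr1.
  by congr (_ - _); rewrite -![_ *: _]/(_ * _) mulr1.
have psi_cont : {within `[0, 1], continuous psi}.
  by apply: derivable_within_continuous => t /psiD[].
have psiDo (t : R) : t \in `]0, 1[ -> is_derive t 1 psi (dpsi t).
  by move=> t01; apply: psiD; exact: subset_itv_oo_cc.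
have [t] := @MVT R psi dpsi 0 1 ltr01 psiDo psi_cont.
rewrite in_itv/= => /andP[t0 t1].
rewrite /psi /dpsi !fctE scale1r scale0r addr0 => E.
have yvz : y + v = z by rewrite /v addrC subrK.
have : dot (grad f (y + t *: v)) v - a <= L * t * norm2 v ^+ 2.
  rewrite -dotBl (le_trans (ler_norm _))// (le_trans (cauchy_schwarz _ _))//.
  rewrite expr2 mulrA ler_wpM2r ?norm2_ge0// (le_trans (lip _ _ _ _))//.
    by apply: Xt; rewrite !ltW.
  by rewrite [y + _]addrC addrK norm2Z (gtr0_norm t0) mulrA lexx.
have sq1 : (1 : R) ^+ 2 = 1 by rewrite expr1n.
have sq0 : (0 : R) ^+ 2 = 0 by rewrite expr0n.
move: E; rewrite yvz sq1 sq0 -/a /b -![_ *: _]/(_ * _).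
set nv := norm2 v ^+ 2.
lra.
Qed.

End Descent.

(** * Lower integrals *)

Section LowerIntegral.
Local Open Scope ereal_scope.
Context d (T : measurableType d) (R : realType).
Variable mu : {measure set T -> \bar R}.
Implicit Types f g : T -> \bar R.

Import HBNNSimple.

(** The integral of a nonnegative function is a supremum over the simple
    functions below it, so monotonicity and superadditivity hold without
    measurability. *)
Lemma ge0_le_lower_integral f g : (forall w, 0 <= f w) ->
  (forall w, f w <= g w) -> \int[mu]_w f w <= \int[mu]_w g w.
Proof.
move=> f0 fg; have g0 w : 0 <= g w by rewrite (le_trans (f0 w)).
rewrite !ge0_integralTE//; apply: ereal_sup_le => _ /= [h hf <-].
by exists h => // w; rewrite (le_trans (hf w)).
Qed.

(** The integrals may be infinite, whence the case distinctions that precede the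
    subtractions. *)
Lemma ge0_lower_integralD f g : (forall w, 0 <= f w) -> (forall w, 0 <= g w) ->
  \int[mu]_w f w + \int[mu]_w g w <= \int[mu]_w (f w + g w).
Proof.
move=> f0 g0; have fg0 w : 0 <= f w + g w by rewrite adde_ge0.
have [->|] := eqVneq (\int[mu]_w (f w + g w)) +oo; first by rewrite leey.
rewrite -ltey => fgoo.
have foo : \int[mu]_w f w < +oo.
  by apply: le_lt_trans fgoo; apply: ge0_le_lower_integral => // w; rewrite leeDl.
have fin : \int[mu]_w f w \is a fin_num.
  by rewrite ge0_fin_numE// integral_ge0.
rewrite addeC -leeBrDr//.
rewrite [X in X <= _]ge0_integralTE//; apply: ge_ereal_sup => _ /= [h2 h2g <-].
have [h2oo|] := eqVneq (sintegral mu h2) +oo.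
  suff : \int[mu]_w (f w + g w) = +oo by move=> E; rewrite E ltxx in fgoo.
  apply/eqP; rewrite -leye_eq -h2oo ge0_integralTE//.
  by apply: ereal_sup_ubound; exists h2 => // w; rewrite (le_trans (h2g w))// leeDr.
rewrite -ltey => h2oo.
have h2fin : sintegral mu h2 \is a fin_num by rewrite ge0_fin_numE// sintegral_ge0.
rewrite leeBrDr// addeC -leeBrDr//.
rewrite [X in X <= _]ge0_integralTE//; apply: ge_ereal_sup => _ /= [h1 h1f <-].
rewrite leeBrDr// -sintegralD// ge0_integralTE//.
apply: ereal_sup_ubound; exists (add_nnsfun h1 h2) => // w.
by rewrite /= EFinD leeD.
Qed.

Lemma ge0_lower_integral_sum (I : Type) (s : seq I) (f : I -> T -> \bar R) :
  (forall i w, 0 <= f i w) ->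
  \sum_(i <- s) \int[mu]_w f i w <= \int[mu]_w \sum_(i <- s) f i w.
Proof.
move=> f0; elim: s => [|i s ih].
  by rewrite big_nil; apply: integral_ge0 => w _; rewrite big_nil.
rewrite big_cons; apply: le_trans (leeD2l _ ih) _.
under [leRHS]eq_integral do rewrite big_cons.
by apply: ge0_lower_integralD => // w; apply: sume_ge0.
Qed.

End LowerIntegral.

(** * Expectations and conditional expectations *)

Section Expectation.
Context d (T : measurableType d) (R : realType) (P : probability T R).
Implicit Types X Y Z : T -> R.

Local Notation integ X := (P.-integrable setT (EFin \o X)).
(* The expectation as a real number, with value 0 when the integral is infinite. *)
Local Notation Ex X := (Rintegral P setT X).

Lemma integ_meas X : integ X -> measurable_fun setT X.
Proof. by move/(measurable_int P)/measurable_EFinP. Qed.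

Lemma eq_Ex X Y : X =1 Y -> Ex X = Ex Y.
Proof. by move/funext->. Qed.

Lemma integ_cst c : integ (fun=> c).
Proof. exact: finite_measure_integrable_cst. Qed.

Lemma Ex_cst c : Ex (fun=> c) = c.
Proof. by rewrite /Rintegral integral_cst//= probability_setT mule1. Qed.

Lemma integD X Y : integ X -> integ Y -> integ (fun w => X w + Y w).
Proof. by move=> iX iY; exact: (integrableD measurableT iX iY). Qed.

Lemma integB X Y : integ X -> integ Y -> integ (fun w => X w - Y w).
Proof. by move=> iX iY; exact: (integrableB measurableT iX iY). Qed.

Lemma integZ a X : integ X -> integ (fun w => a * X w).
Proof. by move=> iX; exact: (integrableZl measurableT a iX). Qed.

Lemma integ_le X Y : measurable_fun setT X -> (forall w, `|X w| <= Y w) ->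
  integ Y -> integ X.
Proof.
move=> mX XY iY; apply: le_integrable iY => //; first exact/measurable_EFinP.
move=> w _ /=; rewrite lee_fin.
by rewrite (le_trans (XY w)) ?ler_norm.
Qed.

Lemma integ_sum (I : Type) (s : seq I) (F : I -> T -> R) :
  (forall i, integ (F i)) -> integ (fun w => \sum_(i <- s) F i w).
Proof.
move=> iF; rewrite (_ : EFin \o _ = fun w => (\sum_(i <- s) (F i w)%:E)%E).
  by apply: integrable_sum => // i _; exact: iF.
by apply/funext => w /=; rewrite sumEFin.
Qed.

Lemma Ex_sum (I : Type) (s : seq I) (F : I -> T -> R) :
  (forall i, integ (F i)) ->
  Ex (fun w => \sum_(i <- s) F i w) = \sum_(i <- s) Ex (F i).
Proof.
move=> iF; elim: s => [|i s ih].
  by under eq_Ex do rewrite big_nil; rewrite big_nil Ex_cst.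
under eq_Ex do rewrite big_cons.
by rewrite RintegralD ?integ_sum// big_cons ih.
Qed.

Lemma ExD X Y : integ X -> integ Y -> Ex (fun w => X w + Y w) = Ex X + Ex Y.
Proof. exact: RintegralD. Qed.

Lemma ExB X Y : integ X -> integ Y -> Ex (fun w => X w - Y w) = Ex X - Ex Y.
Proof. exact: RintegralB. Qed.

Lemma ExZ a X : integ X -> Ex (fun w => a * X w) = a * Ex X.
Proof. exact: RintegralZl. Qed.

Lemma le_Ex X Y : integ X -> integ Y -> (forall w, X w <= Y w) -> Ex X <= Ex Y.
Proof. by move=> iX iY XY; exact: le_Rintegral. Qed.

Lemma integMbounded X Y k : integ X -> measurable_fun setT Y ->
  (forall w, `|Y w| <= k) -> integ (fun w => X w * Y w).
Proof.
move=> iX mY Yk; apply: (@integ_le _ (fun w => k * `|X w|)).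
- by apply: measurable_funM => //; exact: integ_meas.
- by move=> w; rewrite normrM mulrC ler_wpM2r.
- by apply: integZ; exact: integrable_norm.
Qed.

Lemma ae_le_Ex Z c : integ Z -> {ae P, forall w, Z w <= c} -> Ex Z <= c.
Proof.
move=> iZ Zc; have mZ := integ_meas iZ.
(* Z is almost surely equal to its truncation at c. *)
pose Z' w := Num.min (Z w) c.
have mZ' : measurable_fun setT Z' by exact: measurable_minr.
have iZ' : integ Z'.
  apply: (@integ_le _ (fun w => `|Z w| + `|c|)) => //.
    by move=> w; rewrite /Z' minEle; case: ifP; rewrite ?lerDl ?lerDr.
  by apply: integD; [exact: integrable_norm|exact: integ_cst].
have -> : Ex Z = Ex Z'.
  congr fine; apply: ae_eq_integral => //; [exact/measurable_EFinP..|].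
  by apply: filterS Zc => w Zw _; rewrite /Z' min_l.
rewrite -[leRHS]Ex_cst; apply: le_Ex => // [|w]; first exact: integ_cst.
by rewrite ge_min lexx orbT.
Qed.

Lemma staircase_approx (K : nat) (y : R) : 0 <= y <= K%:R ->
  `|y - \sum_(1 <= j < K.+1) (j%:R <= y :> R)%:R| <= 1.
Proof.
elim: K => [|K ih] /andP[y0 yK].
  by rewrite big_geq// subr0 (le_trans _ ler01)// ger0_norm.
rewrite big_nat_recr//=; have [yK'|Ky] := leP y K%:R.
  have -> : (K.+1%:R <= y :> R) = false.
    by apply/negbTE; rewrite -ltNge (le_lt_trans yK')// ltr_nat.
  by rewrite addr0 ih// y0.
rewrite (eq_big_nat _ _ (F2 := fun=> 1)); last first.
  by move=> j /andP[_ jK]; rewrite (le_trans _ (ltW Ky))// ler_nat.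
rewrite sumr_const_nat subn1/= -natr1 in yK *.
by case: (_ <= y); rewrite /= ler_norml; apply/andP; split; lra.
Qed.

(** Taking out what is known: Y is approximated uniformly by step functions
    over the sets {Y >= t}, which belong to G. *)
Lemma cond_expectation_pull_out (G : set (set T)) X Z Y (k : R) :
  is_cond_expectation P G X Z -> measurable_fun setT Y ->
  (forall B, measurable B -> G (Y @^-1` B)) -> (forall w, `|Y w| <= k) ->
  Ex (fun w => X w * Y w) = Ex (fun w => Z w * Y w).
Proof.
move=> [iX iZ _ XZ] mY GY Yk.
pose D w := X w - Z w; have iD : integ D by exact: integB.
have D0 A : measurable A -> G A -> Ex (fun w => D w * \1_A w) = 0.
  move=> mA GA; rewrite (_ : Ex _ = \int[P]_(w in A) D w); last first.
    rewrite [RHS]Rintegral_mkcond; apply: eq_Ex => w.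
    by rewrite patchE indicE; case: ifP; rewrite ?mulr1 ?mulr0.
  rewrite RintegralB//; last 2 first.
  - by apply: integrableS iX.
  - by apply: integrableS iZ.
  by rewrite /Rintegral XZ// subrr.
suff DY0 : Ex (fun w => D w * Y w) = 0.
  apply/eqP; rewrite -subr_eq0 -ExB; [|exact: (integMbounded _ _ Yk)..].
  by rewrite -[X in _ == X]DY0; apply/eqP; apply: eq_Ex => w; rewrite mulrBl.
pose C := Ex (fun w => `|D w|).
(* Yn is Y + k rounded down to a multiple of 1 / N, minus k; the integral of
   D Yn vanishes. *)
have bound (N : nat) : (0 < N)%N -> `|Ex (fun w => D w * Y w)| <= N%:R^-1 * C.
  move=> N0; have Npos : 0 < N%:R :> R by rewrite ltr0n.
  (* N (Y + k) lies in [0, 2 N k], so K steps cover its range. *)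
  pose K := (Num.truncn (N%:R * (k + k))).+1.
  pose A (j : nat) := [set w | j%:R <= N%:R * (Y w + k)].
  have AE j : A j = Y @^-1` `[j%:R / N%:R - k, +oo[.
    apply/seteqP; split => w; rewrite /A /= in_itv/= andbT;
      by rewrite lerBlDr ler_pdivrMr// mulrC.
  have mA j : measurable (A j).
    by rewrite AE -[X in measurable X]setTI; exact: mY.
  have GA j : G (A j) by rewrite AE; exact: GY.
  pose Yn w := N%:R^-1 * (\sum_(1 <= j < K.+1) \1_(A j) w) - k.
  have YYn w : `|Y w - Yn w| <= N%:R^-1.
    have -> : Y w - Yn w = N%:R^-1 *
        (N%:R * (Y w + k) - \sum_(1 <= j < K.+1) (j%:R <= N%:R * (Y w + k) :> R)%:R).
      rewrite mulrBr mulKf ?gt_eqF// /Yn opprB addrA.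
      congr (_ - _ * _).
      apply: eq_bigr => j _; rewrite indicE; congr (nat_of_bool _)%:R.
      by apply/idP/idP; rewrite inE.
    have Nge : 0 <= N%:R^-1 :> R by rewrite invr_ge0 ltW.
    rewrite normrM (ger0_norm Nge) ler_piMr//.
    apply: staircase_approx; have := Yk w; rewrite ler_norml => /andP[Y1 Y2].
    rewrite mulr_ge0 ?ler0n//=; last by rewrite -lerBlDr sub0r.
    rewrite (@le_trans _ _ (N%:R * (k + k)))//.
      by rewrite ler_wpM2l ?ler0n// lerD2r.
    by rewrite ltW// /K truncnS_gt.
  have iDA j : integ (fun w => D w * \1_(A j) w).
    apply: (@integMbounded _ _ 1) => // w.
    by rewrite indicE ger0_norm// lern1 leq_b1.
  have DYn0 : Ex (fun w => D w * Yn w) = 0.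
    rewrite (_ : Ex _ = Ex (fun w => N%:R^-1 *
       (\sum_(1 <= j < K.+1) D w * \1_(A j) w) - k * (D w * \1_setT w))); last first.
      apply: eq_Ex => w.
      by rewrite /Yn -mulr_sumr indicT mulr1 mulrBr [k * _]mulrC mulrCA.
    have iDT : integ (fun w => D w * \1_setT w).
      by rewrite indicT; under eq_fun do rewrite mulr1.
    rewrite ExB; [|by apply/integZ/integ_sum => j; exact: iDA|exact: integZ].
    rewrite !ExZ ?integ_sum// Ex_sum// big1 => [|j _]; last by rewrite D0.
    rewrite D0 ?mulr0 ?subrr//.
    by have := GY setT measurableT; rewrite preimage_setT.
  have iDY : integ (fun w => D w * Y w) by exact: integMbounded Yk.
  have mYn : measurable_fun setT Yn.
    apply: measurable_funB => //; apply: measurable_funM => //.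
    by apply: measurable_sum => j; exact: measurable_indic.
  have iDd : integ (fun w => D w * (Y w - Yn w)).
    by apply: (integMbounded iD _ YYn); exact: measurable_funB.
  have -> : Ex (fun w => D w * Y w) = Ex (fun w => D w * (Y w - Yn w)).
    rewrite -[LHS]subr0 -DYn0 -ExB//; last first.
      have -> : (fun w => D w * Yn w) = (fun w => D w * Y w - D w * (Y w - Yn w)).
        by apply/funext => w; ring.
      exact: integB.
    by apply: eq_Ex => w; rewrite -mulrBr.
  apply: le_trans (le_normr_Rintegral _ iDd) _ => //.
  rewrite -ExZ; last exact: integrable_norm.
  apply: le_Ex; [exact: integrable_norm|by apply: integZ; exact: integrable_norm|].
  by move=> w; rewrite normrM mulrC ler_wpM2r.
apply/eqP; rewrite -normr_le0 leNgt; apply/negP => DYpos.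
have C0 : 0 <= C by exact: Rintegral_ge0.
pose N := (Num.truncn (C / `|Ex (fun w => D w * Y w)|)).+1.
have := bound N isT; rewrite leNgt => /negP; apply.
rewrite mulrC ltr_pdivrMr ?ltr0n// mulrC -ltr_pdivrMr//.
exact: truncnS_gt.
Qed.

End Expectation.

(** * Moment bounds for the heavy-ball momentum *)

Section Momentum.
Context dT (T : measurableType dT) (R : realType) (P : probability T R) (n : nat).
Local Notation integ X := (P.-integrable setT (EFin \o X)).
Local Notation Ex X := (Rintegral P setT X).

Lemma measurable_dot (a b : T -> 'cV[R]_n) :
  (forall i, measurable_fun setT (fun w => a w i 0)) ->
  (forall i, measurable_fun setT (fun w => b w i 0)) ->
  measurable_fun setT (fun w => dot (a w) (b w)).
Proof.
move=> ma mb; under eq_fun do rewrite dotE.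
by apply: measurable_sum => i; exact: measurable_funM.
Qed.

Lemma dot_AMGM (a b : 'cV[R]_n) : `|dot a b| <= 2^-1 * (dot a a + dot b b).
Proof.
apply: le_trans (cauchy_schwarz a b) _; rewrite -!sqr_norm2.
by have := sqr_ge0 (norm2 a - norm2 b); nra.
Qed.

Lemma integ_dot (a b : T -> 'cV[R]_n) :
  (forall i, measurable_fun setT (fun w => a w i 0)) ->
  (forall i, measurable_fun setT (fun w => b w i 0)) ->
  integ (fun w => dot (a w) (a w)) -> integ (fun w => dot (b w) (b w)) ->
  integ (fun w => dot (a w) (b w)).
Proof.
move=> ma mb ia ib; apply: (@integ_le _ _ _ _ _
    (fun w => 2^-1 * (dot (a w) (a w) + dot (b w) (b w)))).
- exact: measurable_dot.
- by move=> w; exact: dot_AMGM.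
- by apply: integZ; exact: integD.
Qed.

(** G_k plays the role of the projected gradient, p_k that of its stochastic
    estimate and r_k that of the momentum. *)
Context (F : nat -> set (set T)) (G p r : nat -> T -> 'cV[R]_n).
Context (beta kf M : R) (h : nat -> R) (h_min h_max : R).
Hypothesis beta_ge0 : 0 <= beta.
Hypothesis beta_lt1 : beta < 1.
Hypothesis h_min_gt0 : 0 < h_min.
Hypothesis h_range : forall k, (1 <= k)%N -> h_min <= h k <= h_max.
Hypothesis G_bd : forall k w, (1 <= k)%N -> norm2 (G k w) <= kf.
Hypothesis unbiased : forall k (i : 'I_n), (1 <= k)%N ->
  is_cond_expectation P (F k) (fun w => p k w i 0) (fun w => G k w i 0).
Hypothesis variance_integ : forall k, (1 <= k)%N ->
  integ (fun w => dot (p k w - G k w) (p k w - G k w)).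
Hypothesis variance_le : forall k, (1 <= k)%N ->
  Ex (fun w => dot (p k w - G k w) (p k w - G k w)) <= M ^+ 2.
Hypothesis r0 : forall w, r 0%N w = 0.
Hypothesis rS : forall k w,
  r k.+1 w = beta *: r k w - (h k.+1)^-1 *: p k.+1 w.

Let h_gt0 k : (1 <= k)%N -> 0 < h k.
Proof. by move=> /h_range/andP[+ _]; apply: lt_le_trans. Qed.

Let G_meas k i : (1 <= k)%N -> measurable_fun setT (fun w => G k w i 0).
Proof. by move=> k1; have [_ iG _ _] := unbiased i k1; exact: integ_meas iG. Qed.

Let p_meas k i : (1 <= k)%N -> measurable_fun setT (fun w => p k w i 0).
Proof. by move=> k1; have [ip _ _ _] := unbiased i k1; exact: integ_meas ip. Qed.

Let r_meas k i : measurable_fun setT (fun w => r k w i 0).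
Proof.
elim: k => [|k ih].
  by under eq_fun do rewrite r0 mxE; exact: measurable_cst.
under eq_fun do rewrite rS !mxE.
apply: measurable_funB; apply: measurable_funM => //.
exact: p_meas.
Qed.

Let G_coord_bd k i w : (1 <= k)%N -> `|G k w i 0| <= kf.
Proof.
move=> k1; apply: le_trans (G_bd w k1).
rewrite -ler_sqr ?nnegrE ?norm2_ge0// sqr_norm2 dotE (bigD1 i)//=.
rewrite real_normK ?num_real// expr2 lerDl; apply: sumr_ge0 => j _.
by rewrite -expr2 sqr_ge0.
Qed.

Lemma projected_gradient_sq_bd k w : (1 <= k)%N -> dot (G k w) (G k w) <= kf ^+ 2.
Proof.
move=> k1; rewrite -sqr_norm2; have := G_bd w k1; have := norm2_ge0 (G k w).
nra.
Qed.

Lemma integ_projected_gradient_sq k : (1 <= k)%N ->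
  integ (fun w => dot (G k w) (G k w)).
Proof.
move=> k1; apply: (@integ_le _ _ _ _ _ (fun=> kf ^+ 2)); last exact: integ_cst.
  by apply: measurable_dot => i; exact: G_meas.
by move=> w; rewrite ger0_norm ?dot_ge0 ?projected_gradient_sq_bd.
Qed.

Let integ_estimate_sq k : (1 <= k)%N -> integ (fun w => dot (p k w) (p k w)).
Proof.
move=> k1; apply: (@integ_le _ _ _ _ _ (fun w =>
    2 * dot (p k w - G k w) (p k w - G k w) + 2 * dot (G k w) (G k w))).
- by apply: measurable_dot => i; exact: p_meas.
- move=> w; rewrite ger0_norm ?dot_ge0//.
  have := dot_ge0 (p k w - G k w - G k w).
  rewrite !(dotBl, dotBr) (dotC (G k w) (p k w)); lra.
- apply: integD; apply: integZ; first exact: variance_integ.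
  exact: integ_projected_gradient_sq.
Qed.

Let integ_dotGp k : (1 <= k)%N -> integ (fun w => dot (G k w) (p k w)).
Proof.
move=> k1; apply: integ_dot => [i|i||]; [exact: G_meas|exact: p_meas| |].
  exact: integ_projected_gradient_sq.
exact: integ_estimate_sq.
Qed.

(** The projected gradient is known at step k, so the estimate may be replaced
    by its conditional expectation inside the inner product with it. *)
Lemma Ex_dot_projected_gradient k : (1 <= k)%N ->
  Ex (fun w => dot (G k w) (p k w)) = Ex (fun w => dot (G k w) (G k w)).
Proof.
move=> k1.
have iM i (Y : T -> R) : integ Y -> integ (fun w => Y w * G k w i 0).
  move=> iY; apply: (@integMbounded _ _ _ _ _ _ kf) => //; first exact: G_meas.
  by move=> w; exact: G_coord_bd.
under eq_Ex do rewrite dotC dotE.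
under [RHS]eq_Ex do rewrite dotE.
rewrite !Ex_sum => [|i|i]; last 2 first.
- by apply: iM; have [] := unbiased i k1.
- by apply: iM; have [] := unbiased i k1.
apply: eq_bigr => i _.
have [_ _ GF _] := unbiased i k1.
apply: (cond_expectation_pull_out (k := kf) (unbiased i k1)) => //.
  exact: G_meas.
by move=> w; exact: G_coord_bd.
Qed.

Lemma Ex_estimate_sq k : (1 <= k)%N ->
  Ex (fun w => dot (p k w) (p k w)) <= kf ^+ 2 + M ^+ 2.
Proof.
move=> k1; have iV := variance_integ k1; have iG := integ_projected_gradient_sq k1.
have iGp := integ_dotGp k1.
(* |p|^2 = |p - G|^2 + 2 G.p - |G|^2, where E[G.p] = E|G|^2. *)
have -> : Ex (fun w => dot (p k w) (p k w)) =
    Ex (fun w => dot (p k w - G k w) (p k w - G k w) +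
                 (2 * dot (G k w) (p k w) - dot (G k w) (G k w))).
  apply: eq_Ex => w; rewrite !(dotBl, dotBr) (dotC (p k w) (G k w)); ring.
rewrite ExD//; last by apply: integB => //; exact: integZ.
rewrite ExB//; last exact: integZ.
rewrite ExZ// Ex_dot_projected_gradient//.
have := variance_le k1.
have : Ex (fun w => dot (G k w) (G k w)) <= kf ^+ 2.
  rewrite -[leRHS](Ex_cst P); apply: le_Ex => //; first exact: integ_cst.
  by move=> w; exact: projected_gradient_sq_bd.
lra.
Qed.

(** The bound on the second moment of the momentum: that of u_k, which is
    (kf^2 + M^2) / h_min^2, amplified by (1 - beta)^-2. *)
Definition momentum_bound := (kf ^+ 2 + M ^+ 2) / (h_min ^+ 2 * (1 - beta) ^+ 2).

Lemma momentum_bound_ge0 : 0 <= momentum_bound.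
Proof.
rewrite /momentum_bound divr_ge0//; first by rewrite addr_ge0 ?sqr_ge0.
by rewrite mulr_ge0 ?sqr_ge0.
Qed.

Let b1 : 0 < 1 - beta. Proof. by rewrite subr_gt0. Qed.

(** Convexity of the squared norm, applied to the convex combination
    beta r + (1 - beta) (u / (1 - beta)). *)
Lemma momentum_sq_le k w : dot (r k.+1 w) (r k.+1 w) <=
  beta * dot (r k w) (r k w) +
  ((h_min ^+ 2) * (1 - beta))^-1 * dot (p k.+1 w) (p k.+1 w).
Proof.
have hk := h_gt0 (ltn0Sn k).
have /andP[hmk _] := h_range (ltn0Sn k).
set u := (h k.+1)^-1 *: p k.+1 w.
have u_le : dot u u <= (h_min ^+ 2)^-1 * dot (p k.+1 w) (p k.+1 w).
  rewrite dotZl dotZr mulrA ler_wpM2r ?dot_ge0// -expr2 exprVn.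
  by rewrite lef_pV2 ?posrE ?exprn_gt0// ler_sqr// nnegrE ltW.
rewrite rS -/u invfM mulrAC.
apply: (@le_trans _ _ (beta * dot (r k w) (r k w) + dot u u / (1 - beta))).
  clearbody u; rewrite -(ler_pM2r b1) [leRHS]mulrDl divfK ?gt_eqF//.
  have := mulr_ge0 beta_ge0 (dot_ge0 ((1 - beta) *: r k w + u)).
  rewrite !(dotBl, dotBr, dotDl, dotDr, dotZl, dotZr) (dotC u (r k w)).
  by move: (dot _ _) (dot _ _) (dot _ _) => x y z; lra.
by rewrite lerD2l ler_wpM2r// invr_ge0 ltW.
Qed.

Lemma integ_momentum_sq k : integ (fun w => dot (r k w) (r k w)).
Proof.
elim: k => [|k ih].
  rewrite (_ : EFin \o _ = EFin \o (fun=> 0)); first exact: integ_cst.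
  by apply/funext => w; rewrite /= r0 /dot mulmx0 mxE.
apply: (integ_le _ (Y := fun w => beta * dot (r k w) (r k w) +
  ((h_min ^+ 2) * (1 - beta))^-1 * dot (p k.+1 w) (p k.+1 w))).
- by apply: measurable_dot => i; exact: r_meas.
- by move=> w; rewrite ger0_norm ?dot_ge0 ?momentum_sq_le.
- by apply: integD; apply: integZ => //; exact: integ_estimate_sq.
Qed.

Lemma Ex_momentum_sq k : Ex (fun w => dot (r k w) (r k w)) <= momentum_bound.
Proof.
elim: k => [|k ih].
  under eq_Ex do rewrite r0 /dot mulmx0 mxE.
  by rewrite Ex_cst momentum_bound_ge0.
have ir := integ_momentum_sq k; have ip := integ_estimate_sq (ltn0Sn k).
apply: (@le_trans _ _ (Ex (fun w => beta * dot (r k w) (r k w) +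
  ((h_min ^+ 2) * (1 - beta))^-1 * dot (p k.+1 w) (p k.+1 w)))).
  apply: le_Ex; [exact: integ_momentum_sq| |exact: momentum_sq_le].
  by apply: integD; exact: integZ.
rewrite ExD ?integZ// !ExZ//.
have -> : momentum_bound = beta * momentum_bound +
    ((h_min ^+ 2) * (1 - beta))^-1 * (kf ^+ 2 + M ^+ 2).
  by rewrite /momentum_bound; field; rewrite !gt_eqF.
apply: lerD; first exact: ler_wpM2l.
apply: ler_wpM2l (Ex_estimate_sq _) => //.
by rewrite invr_ge0 mulr_ge0 ?sqr_ge0 ?ltW.
Qed.

(** ** Correlation of the projected gradient with the momentum *)

Context (lip V : R).
Hypothesis lip_ge0 : 0 <= lip.
Hypothesis V_ge0 : 0 <= V.
Hypothesis gradient_drift : forall k w, (1 <= k)%N ->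
  dot (G k.+1 w) (r k w) <=
  dot (G k w) (r k w) + lip * (V / 2 + dot (r k w) (r k w)).

Lemma integ_gradient_momentum k j : (1 <= k)%N ->
  integ (fun w => dot (G k w) (r j w)).
Proof.
move=> k1; apply: integ_dot => [i|i||]; [exact: G_meas|exact: r_meas| |].
  exact: integ_projected_gradient_sq.
exact: integ_momentum_sq.
Qed.

Let Ex_gradient_momentumS k : Ex (fun w => dot (G k.+1 w) (r k.+1 w)) =
  beta * Ex (fun w => dot (G k.+1 w) (r k w)) -
  (h k.+1)^-1 * Ex (fun w => dot (G k.+1 w) (G k.+1 w)).
Proof.
rewrite -Ex_dot_projected_gradient//.
have i1 := @integ_gradient_momentum k.+1 k isT.
have i2 := @integ_dotGp k.+1 isT.
rewrite -!ExZ// -ExB ?integZ//.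
by apply: eq_Ex => w; rewrite rS dotBr !dotZr.
Qed.

(** The accumulated drift of the gradient: the sum of the geometric series of
    ratio beta whose first term bounds the expected drift over one step. *)
Definition correlation_bound := lip * (V / 2 + momentum_bound) / (1 - beta).

Let correlation_bound_ge0 : 0 <= correlation_bound.
Proof.
rewrite divr_ge0//; last exact: ltW.
by rewrite mulr_ge0// addr_ge0 ?momentum_bound_ge0// divr_ge0.
Qed.

(** Each step multiplies the past correlation by beta, adds the drift of the
    gradient and subtracts the new descent; the drift sums geometrically. *)
Lemma Ex_gradient_momentum k : (1 <= k)%N ->
  Ex (fun w => dot (G k w) (r k w)) <=
  beta * correlation_bound - (h k)^-1 * Ex (fun w => dot (G k w) (G k w)).
Proof.
case: k => // k _; elim: k => [|k ih]; rewrite Ex_gradient_momentumS lerD2r.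
  under eq_Ex do rewrite r0 /dot mulmx0 mxE.
  by rewrite Ex_cst mulr0 mulr_ge0 ?correlation_bound_ge0.
apply: ler_wpM2l => //.
apply: (@le_trans _ _ (Ex (fun w => dot (G k.+1 w) (r k.+1 w) +
    lip * (V / 2 + dot (r k.+1 w) (r k.+1 w))))).
  have iD : integ (fun w => V / 2 + dot (r k.+1 w) (r k.+1 w)).
    by apply: integD; [exact: integ_cst|exact: integ_momentum_sq].
  apply: le_Ex; first exact: integ_gradient_momentum.
    by apply: integD; [exact: integ_gradient_momentum|exact: integZ].
  by move=> w; exact: gradient_drift.
have iD : integ (fun w => V / 2 + dot (r k.+1 w) (r k.+1 w)).
  by apply: integD; [exact: integ_cst|exact: integ_momentum_sq].
rewrite ExD ?integ_gradient_momentum ?integZ// ExZ// ExD ?integ_cst ?integ_momentum_sq//.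
rewrite Ex_cst.
have -> : correlation_bound =
    beta * correlation_bound + lip * (V / 2 + momentum_bound).
  by rewrite /correlation_bound; field; rewrite gt_eqF.
apply: lerD; last by rewrite ler_wpM2l// lerD2l Ex_momentum_sq.
apply: le_trans ih _; rewrite gerBl.
apply: mulr_ge0; first by rewrite invr_ge0 ltW// h_gt0.
by apply: Rintegral_ge0 => w _; exact: dot_ge0.
Qed.

Lemma Ex_gradient_momentum_descent k : (1 <= k)%N ->
  Ex (fun w => h_max^-1 * dot (G k w) (G k w) + dot (G k w) (r k w)) <=
  beta * correlation_bound.
Proof.
move=> k1; have /andP[hmk hkM] := h_range k1.
rewrite ExD ?integ_gradient_momentum// ?integZ ?integ_projected_gradient_sq//.
rewrite ExZ ?integ_projected_gradient_sq//.
rewrite addrC -lerBrDr; apply: le_trans (Ex_gradient_momentum k1) _.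
rewrite lerD2l lerN2 ler_wpM2r//.
  by apply: Rintegral_ge0 => w _; exact: dot_ge0.
have hk := h_gt0 k1.
by rewrite lef_pV2 ?posrE// (lt_le_trans hk).
Qed.

End Momentum.

(** * Decrease of the merit function along one step *)

Section Step.
Context (R : realType) (m n : nat) (J : 'M[R]_(m, n)) (c : 'cV[R]_m) (r : 'cV[R]_n).
Context (rho rho_max kc s : R).
Hypothesis s_gt0 : 0 < s.
Hypothesis s_le : s <= smallest_singular_value J.
Hypothesis rho_bd : 0 <= rho <= rho_max.
Hypothesis c_le : norm2 c <= kc.

(** v is the normal step; d adds to it the tangential part of the momentum r. *)
Let v := - (rho *: (J^T *m invmx (J *m J^T) *m c)).
Let d := v + kernel_projector J *m r.

Lemma norm2_normal_step : norm2 v <= rho_max / s * norm2 c.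
Proof.
have /andP[rho0 rhoM] := rho_bd.
rewrite /v norm2N norm2Z ger0_norm// mulrAC -mulrA.
apply: ler_pM => //; first exact: norm2_ge0.
exact: norm2_least_norm_solution.
Qed.

Lemma mulmx_Jacobian_step : J *m d = - (rho *: c).
Proof.
have Ju := gram_unitmx s_gt0 s_le.
rewrite mulmxDr mulmxA mulmx_kernel_projector// mul0mx addr0.
by rewrite mulmxN -scalemxAr !mulmxA mulmxV// mul1mx.
Qed.

Lemma sqnorm_step : dot d d <= rho_max ^+ 2 * kc ^+ 2 / s ^+ 2 + dot r r.
Proof.
have Ju := gram_unitmx s_gt0 s_le.
have vP : dot v (kernel_projector J *m r) = 0.
  by rewrite dotNl dotZl -mulmxA dot_normal_tangential// mulr0 oppr0.
rewrite dotDl !dotDr (dotC _ v) vP addr0 add0r; apply: lerD; last first.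
  by rewrite -norm2_le norm2_kernel_projector.
have /andP[rho0 rhoM] := rho_bd.
have -> : rho_max ^+ 2 * kc ^+ 2 / s ^+ 2 = (rho_max / s * kc) ^+ 2.
  by rewrite !exprMn exprVn mulrAC.
rewrite -sqr_norm2; apply: lerXn2r; rewrite ?nnegrE ?norm2_ge0//.
  rewrite mulr_ge0 ?divr_ge0 ?(le_trans rho0 rhoM) ?(ltW s_gt0)//.
  exact: le_trans (norm2_ge0 _) c_le.
apply: le_trans norm2_normal_step _; apply: ler_wpM2l => //.
by rewrite divr_ge0 ?(le_trans rho0 rhoM) ?(ltW s_gt0).
Qed.

End Step.

Section MeritDecrease.
Context (R : realType) (m n : nat) (f : 'cV[R]_n -> R) (c : 'cV[R]_n -> 'cV[R]_m).
Context (X : set 'cV[R]_n) (rho rho_min rho_max alpha tau kf kc s Lf LJ LP : R).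
Hypothesis Xconvex : convex_set X.
Hypothesis f_diff : forall y, X y -> differentiable f y.
Hypothesis grad_bd : forall y, X y -> norm2 (grad f y) <= kf.
Hypothesis grad_lip : forall y z, X y -> X z ->
  norm2 (grad f y - grad f z) <= Lf * norm2 (y - z).
Hypothesis c_bd : forall y, X y -> norm2 (c y) <= kc.
Hypothesis s_gt0 : 0 < s.
Hypothesis Jac_sv : forall y, X y -> s <= smallest_singular_value (Jac c y).
Hypothesis c_descent : forall y z, X y -> X z ->
  norm1 (c z) <= norm1 (c y + Jac c y *m (z - y)) + 2^-1 * LJ * norm2 (z - y) ^+ 2.
Hypothesis rho_min_gt0 : 0 < rho_min.
Hypothesis rho_range : rho_min <= rho <= rho_max.
Hypothesis rho_le1 : rho <= 1.
Hypothesis alpha_gt0 : 0 < alpha.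
Hypothesis alpha_le1 : alpha <= 1.
Hypothesis tau_gt0 : 0 < tau.
Hypothesis Lf_gt0 : 0 < Lf.
Hypothesis LJ_gt0 : 0 < LJ.
Hypothesis tauE : 1 - tau * kf * rho_max / (s * rho_min) = tau.

Context (y z r : 'cV[R]_n).
Let d := - (rho *: ((Jac c y)^T *m invmx (Jac c y *m (Jac c y)^T) *m c y))
         + projector c y *m r.
Hypothesis Xy : X y.
Hypothesis Xz : X z.
Hypothesis zE : z = y + alpha *: d.

Let rho_bd : 0 <= rho <= rho_max.
Proof. by have /andP[h1 ->] := rho_range; rewrite (le_trans (ltW rho_min_gt0)). Qed.

Let d_le : dot d d <= rho_max ^+ 2 * kc ^+ 2 / s ^+ 2 + dot r r.
Proof. exact: (sqnorm_step r s_gt0 (Jac_sv Xy) rho_bd (c_bd Xy)). Qed.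

Let zy : z - y = alpha *: d. Proof. by rewrite zE addrC addKr. Qed.

Lemma merit_decrease : merit f c z tau <= merit f c y tau
  + alpha * tau * dot (projector c y *m grad f y) r
  - alpha * tau * rho_min * norm1 (c y)
  + 2^-1 * (tau * Lf + LJ) * alpha ^+ 2
    * (rho_max ^+ 2 * kc ^+ 2 / s ^+ 2 + dot r r).
Proof.
have Ju := gram_unitmx s_gt0 (Jac_sv Xy).
have /andP[rhom rhoM] := rho_range.
have := d_le; set D := _ + dot r r => dD.
have fz := descent_lemma Xconvex f_diff grad_lip Xy Xz.
have cz := c_descent Xy Xz.
have nzy : norm2 (z - y) ^+ 2 = alpha ^+ 2 * dot d d.
  by rewrite sqr_norm2 zy dotZl dotZr mulrA -expr2.
rewrite nzy {1}zy dotZr in fz; rewrite nzy zy -scalemxAr in cz.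
rewrite (mulmx_Jacobian_step (c y) r rho s_gt0 (Jac_sv Xy)) in cz.
have n10 := norm1_ge0 (c y).
set n1 := norm1 (c y) in cz n10 *.
have {}cz : norm1 (c z) <= (1 - alpha * rho_min) * n1
    + 2^-1 * LJ * (alpha ^+ 2 * dot d d).
  apply: le_trans cz _; rewrite lerD2r.
  have -> : c y + alpha *: - (rho *: c y) = (1 - alpha * rho) *: c y.
    by rewrite scalerN scalerA scalerBl scale1r.
  rewrite norm1Z ger0_norm -/n1; last first.
    by rewrite subr_ge0 mulr_ile1 ?(ltW alpha_gt0)//; case/andP: rho_bd.
  by rewrite ler_wpM2r// lerD2l lerN2 ler_pM2l.
have gd : dot (grad f y) d <=
    kf * rho_max / s * n1 + dot (projector c y *m grad f y) r.
  rewrite dotDr (dot_kernel_projector (Jac c y)) lerD2r.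
  apply: le_trans (ler_norm _) _; apply: le_trans (cauchy_schwarz _ _) _.
  rewrite -!mulrA; apply: ler_pM; rewrite ?norm2_ge0 ?grad_bd//.
  apply: le_trans (norm2_normal_step _ s_gt0 (Jac_sv Xy) rho_bd) _.
  rewrite mulrA; apply: ler_wpM2l; last exact: norm2_le_norm1.
  by rewrite divr_ge0 ?(ltW s_gt0)// (le_trans _ rhoM)// (le_trans (ltW rho_min_gt0)).
(* This is where the choice of tau enters. *)
have key : tau * (kf * rho_max / s) = (1 - tau) * rho_min.
  rewrite -{2}tauE; field; rewrite !gt_eqF//.
rewrite /merit -/n1.
set G := dot (projector c y *m grad f y) r in gd *.
have h1 : tau * f z <= tau * f y + tau * alpha * (kf * rho_max / s * n1 + G)
    + 2^-1 * tau * Lf * (alpha ^+ 2 * dot d d).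
  have : tau * f z <= tau * (f y + alpha * dot (grad f y) d +
      2^-1 * Lf * (alpha ^+ 2 * dot d d)) by rewrite ler_pM2l.
  move/le_trans; apply; rewrite !mulrDr !mulrA.
  have : tau * alpha * dot (grad f y) d <=
    tau * alpha * (kf * rho_max / s * n1 + G) by rewrite ler_pM2l ?mulr_gt0.
  lra.
have h2 : 2^-1 * (tau * Lf + LJ) * alpha ^+ 2 * dot d d <=
    2^-1 * (tau * Lf + LJ) * alpha ^+ 2 * D.
  apply: ler_wpM2l dD.
  by rewrite !mulr_ge0 ?sqr_ge0 ?addr_ge0 ?mulr_ge0 ?ltW.
have h3 : tau * alpha * (kf * rho_max / s * n1) = alpha * (1 - tau) * rho_min * n1.
  have -> : tau * alpha * (kf * rho_max / s * n1) =
    alpha * (tau * (kf * rho_max / s)) * n1 by ring.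
  by rewrite key; ring.
rewrite mulrDr h3 in h1; lra.
Qed.

Lemma projected_gradient_drift :
  0 <= LP ->
  norm2 (projector c y *m grad f y - projector c z *m grad f z) <= LP * norm2 (y - z) ->
  dot (projector c z *m grad f z) r <= dot (projector c y *m grad f y) r +
    LP * alpha * (rho_max ^+ 2 * kc ^+ 2 / s ^+ 2 / 2 + dot r r).
Proof.
move=> LP0 lip; set Gy := projector c y *m _ in lip *.
set Gz := projector c z *m _ in lip *.
rewrite -lerBlDl -dotBl; apply: le_trans (ler_norm _) _.
apply: le_trans (cauchy_schwarz _ _) _.
have {}lip : norm2 (Gz - Gy) <= LP * alpha * norm2 d.
  rewrite -norm2N opprB (le_trans lip)// -norm2N opprB zy norm2Z.
  by rewrite gtr0_norm// mulrA.
apply: le_trans (ler_wpM2r (norm2_ge0 r) lip) _.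
rewrite -(mulrA (LP * alpha)); apply: ler_wpM2l; first by rewrite mulr_ge0// ltW.
have := d_le; rewrite -!sqr_norm2.
by have := sqr_ge0 (norm2 d - norm2 r); nra.
Qed.

End MeritDecrease.

(** * The complexity bound *)

Lemma sum_of_decrease (R : realType) (phi a b : nat -> R) (K : nat) :
  (forall k, phi k.+1 <= phi k + b k - a k) ->
  \sum_(0 <= k < K) a k <= phi 0%N - phi K + \sum_(0 <= k < K) b k.
Proof.
move=> dec; elim: K => [|K ih]; first by rewrite !big_geq// subrr addr0.
by rewrite !big_nat_recr//=; have := dec K; lra.
Qed.

Theorem theorem3p1 (R : realType) (m n : nat) (m_le_n : (m <= n)%N)
  (* the problem, with f x = E_xi[F(x, xi)] *)
  (dS : measure_display) (S : measurableType dS) (Q : probability S R)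
  (dU : measure_display) (U : measurableType dU) (xi : {RV Q >-> U})
  (F : 'cV[R]_n -> U -> R)
  (f : 'cV[R]_n -> R) (c : 'cV[R]_n -> 'cV[R]_m)
  (F_int : forall y, Q.-integrable setT (fun s => (F y (xi s))%:E))
  (f_def : forall y, ((f y)%:E = 'E_Q[fun s => F y (xi s)])%E)
  (* the algorithm *)
  (x1 : 'cV[R]_n) (rho h : nat -> R) (beta alpha : R)
  (rho_bd : forall k, (1 <= k)%N -> 0 < rho k <= 1)
  (h_pos : forall k, (1 <= k)%N -> 0 < h k)
  (beta_bd : 0 <= beta < 1) (alpha_bd : 0 < alpha <= 1)
  (dT : measure_display) (T : measurableType dT) (P : probability T R)
  (g x v u r d : nat -> T -> 'cV[R]_n)
  (g_meas : forall k (i : 'I_n), (1 <= k)%N ->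
     measurable_fun setT (fun w => g k w i 0))
  (run : forall w, heavy_ball_sqp_run c x1 rho h beta alpha
     (g^~ w) (x^~ w) (v^~ w) (u^~ w) (r^~ w) (d^~ w))
  (* the set X *)
  (X : set 'cV[R]_n) (X_open : open X) (X_convex : convex_set X)
  (x_in_X : forall k w, (1 <= k)%N -> X (x k w))
  (* assumptions on f and c over X *)
  (f_inf kappa_c kappa_f kappa_J L_f L_Jhat sigma_min : R)
  (f_diff : forall y, X y -> differentiable f y)
  (f_C1 : {within X, continuous (grad f)})
  (f_lb : forall y, X y -> f_inf <= f y)
  (c_diff : forall y, X y -> differentiable c y)
  (c_C1 : {within X, continuous (Jac c)})
  (kappa_c_pos : 0 < kappa_c)
  (c_bd : forall y, X y -> norm2 (c y) <= kappa_c)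
  (kappa_f_pos : 0 < kappa_f) (kappa_J_pos : 0 < kappa_J) (L_f_pos : 0 < L_f)
  (L_Jhat_pos : 0 < L_Jhat) (sigma_min_pos : 0 < sigma_min)
  (grad_bd : forall y, X y -> norm2 (grad f y) <= kappa_f)
  (Jac_bd : forall y, X y -> spectral_norm (Jac c y) <= kappa_J)
  (grad_lip : forall y z, X y -> X z ->
     norm2 (grad f y - grad f z) <= L_f * norm2 (y - z))
  (Jac_lip : forall y z, X y -> X z ->
     spectral_norm (Jac c y - Jac c z) <= L_Jhat * norm2 (y - z))
  (Jac_sv : forall y, X y -> sigma_min <= smallest_singular_value (Jac c y))
  (* assumptions on the stochastic gradients *)
  (M : R)
  (unbiased : forall k (i : 'I_n), (1 <= k)%N ->
     is_cond_expectation P (gradient_filtration g k)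
       (fun w => (projector c (x k w) *m g k w) i 0)
       (fun w => (projector c (x k w) *m grad f (x k w)) i 0))
  (variance : forall k, (1 <= k)%N ->
     exists2 Z : T -> R,
       is_cond_expectation P (gradient_filtration g k)
         (fun w => norm2 (projector c (x k w) *m (g k w - grad f (x k w))) ^+ 2)
         Z &
       {ae P, forall w, Z w <= M ^+ 2})
  (* bounds on the prescribed sequences *)
  (rho_min rho_max h_min h_max : R)
  (rho_min_bd : 0 < rho_min <= 1) (rho_max_bd : 0 < rho_max <= 1)
  (h_min_pos : 0 < h_min) (h_max_pos : 0 < h_max)
  (rho_range : forall k, (1 <= k)%N -> rho_min <= rho k <= rho_max)
  (h_range : forall k, (1 <= k)%N -> h_min <= h k <= h_max)
  (* derived constants *)
  (L_J L_Pf : R) (L_J_pos : 0 < L_J) (L_Pf_pos : 0 < L_Pf)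
  (c_descent : forall y z, X y -> X z ->
     norm1 (c z) <= norm1 (c y + Jac c y *m (z - y))
                    + 2^-1 * L_J * norm2 (z - y) ^+ 2)
  (Pgrad_lip : forall y z, X y -> X z ->
     norm2 (projector c y *m grad f y - projector c z *m grad f z)
       <= L_Pf * norm2 (y - z)) :
  let tau := sigma_min * rho_min / (sigma_min * rho_min + kappa_f * rho_max) in
  let C :=
    beta * L_Pf * tau / (1 - beta)
      * (rho_max ^+ 2 * kappa_c ^+ 2 / (2 * sigma_min ^+ 2)
         + (kappa_f ^+ 2 + M ^+ 2) / (h_min ^+ 2 * (1 - beta) ^+ 2))
    + 2^-1 * (tau * L_f + L_J)
      * (rho_max ^+ 2 * kappa_c ^+ 2 / sigma_min ^+ 2
         + (kappa_f ^+ 2 + M ^+ 2) / (h_min ^+ 2 * (1 - beta) ^+ 2)) in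
  1 - tau * kappa_f * rho_max / (sigma_min * rho_min) = tau /\
  forall K : nat, (0 < K)%N ->
    ((K%:R^-1)%:E * \sum_(1 <= k < K.+1)
        'E_P[fun w => (h_max^-1 * norm2 (projector c (x k w) *m grad f (x k w)) ^+ 2
                      + rho_min * norm1 (c (x k w)))%R]
     <= ((merit f c x1 tau - tau * f_inf) / (alpha * tau * K%:R)
         + alpha * C / tau)%:E)%E.
Proof.
set tau := sigma_min * rho_min / _; set C := _ + _ * _.
have /andP[beta0 beta1] := beta_bd; have /andP[alpha0 alpha1] := alpha_bd.
have /andP[rhom0 _] := rho_min_bd; have /andP[rhoM0 _] := rho_max_bd.
have sr0 : 0 < sigma_min * rho_min by rewrite mulr_gt0.
have kr0 : 0 < kappa_f * rho_max by rewrite mulr_gt0.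
have tau0 : 0 < tau by rewrite divr_gt0// addr_gt0.
have tauE : 1 - tau * kappa_f * rho_max / (sigma_min * rho_min) = tau.
  by rewrite /tau; field; rewrite !gt_eqF// addr_gt0.
split=> // K K0.
pose G k w := projector c (x k w) *m grad f (x k w).
pose p k w := projector c (x k w) *m g k w.
pose V := rho_max ^+ 2 * kappa_c ^+ 2 / sigma_min ^+ 2.
pose c2 := 2^-1 * (tau * L_f + L_J).
have V0 : 0 <= V by rewrite divr_ge0 ?sqr_ge0// mulr_ge0 ?sqr_ge0.
have r0 w : r 0%N w = 0 by have [] := run w.
have rS k w : r k.+1 w = beta *: r k w - (h k.+1)^-1 *: p k.+1 w.
  by have [_ _ /(_ k.+1 isT)[_ -> -> _ _]] := run w.
have xS k w : x k.+2 w = x k.+1 w + alpha *: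
    (- (rho k.+1 *: ((Jac c (x k.+1 w))^T *m
         invmx (Jac c (x k.+1 w) *m (Jac c (x k.+1 w))^T) *m c (x k.+1 w)))
     + projector c (x k.+1 w) *m r k.+1 w).
  have [_ _ /(_ k.+1 isT)/=[vE _ _ dE ->]] := run w.
  by rewrite dE vE.
have x1E w : x 1%N w = x1 by have [] := run w.
have Xk k w : X (x k.+1 w) by exact: x_in_X.
have G_bd k w : (1 <= k)%N -> norm2 (G k w) <= kappa_f.
  case: k => // k _; apply: le_trans _ (grad_bd _ (Xk k w)).
  exact: norm2_kernel_projector (gram_unitmx sigma_min_pos (Jac_sv _ (Xk k w))) _.
have pG k w : dot (p k w - G k w) (p k w - G k w) =
    norm2 (projector c (x k w) *m (g k w - grad f (x k w))) ^+ 2.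
  by rewrite -sqr_norm2 mulmxBr.
have var_int k : (1 <= k)%N -> P.-integrable setT
    (EFin \o (fun w => dot (p k w - G k w) (p k w - G k w))).
  move=> k1; have [Z [iX _ _ _] _] := variance k k1.
  by under [X in EFin \o X]funext do rewrite pG.
have var_le k : (1 <= k)%N ->
    \int[P]_w dot (p k w - G k w) (p k w - G k w) <= M ^+ 2.
  move=> k1; have [Z [iX iZ GZ XZ] ZM] := variance k k1.
  apply: le_trans (ae_le_Ex iZ ZM).
  rewrite le_eqVlt; apply/orP; left; apply/eqP.
  under eq_Ex do rewrite pG; congr fine; apply: XZ.
  by have := GZ setT measurableT; rewrite preimage_setT.
have drift k w : (1 <= k)%N -> dot (G k.+1 w) (r k w) <=
    dot (G k w) (r k w) + L_Pf * alpha * (V / 2 + dot (r k w) (r k w)).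
  case: k => // k _.
  exact: (projected_gradient_drift c_bd sigma_min_pos Jac_sv rhom0
    (rho_range _ (ltn0Sn k)) alpha0 (Xk k w) (xS k w) (ltW L_Pf_pos)
    (Pgrad_lip _ _ (Xk k w) (Xk k.+1 w))).
have lip0 : 0 <= L_Pf * alpha by rewrite mulr_ge0// ltW.
have iG k := integ_projected_gradient_sq G_bd unbiased (ltn0Sn k).
have ir k := integ_momentum_sq beta0 beta1 h_min_pos h_range G_bd unbiased
  var_int r0 rS k.
have iGr k := integ_gradient_momentum beta0 beta1 h_min_pos h_range G_bd unbiased
  var_int r0 rS k.+1 (ltn0Sn k).
have Er k := Ex_momentum_sq beta0 beta1 h_min_pos h_range G_bd unbiased
  var_int var_le r0 rS k.
have EGr k := Ex_gradient_momentum_descent beta0 beta1 h_min_pos h_range G_bd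
  unbiased var_int var_le r0 rS lip0 V0 drift (ltn0Sn k).
set B := momentum_bound _ _ _ _ in Er.
set E := correlation_bound _ _ _ _ _ _ in EGr.
pose N k w := h_max^-1 * dot (G k w) (G k w) + rho_min * norm1 (c (x k w)).
have N0 k w : 0 <= N k w.
  by rewrite addr_ge0 ?mulr_ge0 ?dot_ge0 ?norm1_ge0 ?invr_ge0// ltW.
(* W k is the part of the majorant coming from step k; it is built from G_k and
   r_k only, hence measurable. *)
pose Dk k w := h_max^-1 * dot (G k w) (G k w) + dot (G k w) (r k w).
pose W k w := Dk k w + c2 * alpha / tau * (V + dot (r k w) (r k w)).
pose A := (merit f c x1 tau - tau * f_inf) / (alpha * tau).
have iDk k : P.-integrable setT (EFin \o Dk k.+1).
  by apply: integD; [apply: integZ; exact: iG|exact: iGr].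
have iV k : P.-integrable setT (EFin \o (fun w => V + dot (r k.+1 w) (r k.+1 w))).
  by apply: integD; [exact: integ_cst|exact: ir].
have iW k : P.-integrable setT (EFin \o W k.+1).
  by apply: integD => //; apply: integZ.
have c20 : 0 <= c2 * alpha / tau.
  have c2_gt0 : 0 < c2 by rewrite mulr_gt0 ?invr_gt0// addr_gt0// mulr_gt0.
  by rewrite ltW// divr_gt0// mulr_gt0.
have EW k : \int[P]_w W k.+1 w <= beta * E + c2 * alpha / tau * (V + B).
  have EV : \int[P]_w (V + dot (r k.+1 w) (r k.+1 w)) =
      V + \int[P]_w dot (r k.+1 w) (r k.+1 w).
    by rewrite ExD ?integ_cst// Ex_cst.
  rewrite ExD ?integZ// ExZ// EV.
  by apply: lerD; [exact: EGr|rewrite ler_wpM2l// lerD2l Er].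
have path w : \sum_(0 <= k < K) N k.+1 w <= A + \sum_(0 <= k < K) W k.+1 w.
  have at0 : 0 < alpha * tau by rewrite mulr_gt0.
  pose phi k := merit f c (x k.+1 w) tau / (alpha * tau).
  (* The term |G_k|^2 / h_max, absent from the merit decrease, occurs in both W and
     N and cancels. *)
  have dec k : phi k.+1 <= phi k + W k.+1 w - N k.+1 w.
    have /andP[_ rho1] := rho_bd _ (ltn0Sn k).
    have := merit_decrease X_convex f_diff grad_bd grad_lip c_bd sigma_min_pos
      Jac_sv c_descent rhom0 (rho_range _ (ltn0Sn k)) rho1 alpha0 alpha1 tau0
      L_f_pos L_J_pos tauE (Xk k w) (Xk k.+1 w) (xS k w).
    rewrite -/(G k.+1 w) -/V -/c2 => md.
    rewrite -(ler_pM2r at0) /phi divfK ?gt_eqF//; apply: le_trans md _.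
    rewrite mulrBl mulrDl divfK ?gt_eqF// /W /N /Dk.
    rewrite le_eqVlt; apply/orP; left; apply/eqP; field.
    by rewrite !gt_eqF.
  apply: le_trans (sum_of_decrease K dec) _; rewrite lerD2r /A mulrBl /phi x1E.
  rewrite lerD2l lerN2 ler_pM2r ?invr_gt0// /merit.
  have := norm1_ge0 (c (x K.+1 w)).
  have : tau * f_inf <= tau * f (x K.+1 w) by rewrite ler_pM2l// f_lb.
  lra.
have EN : (\sum_(1 <= k < K.+1)
    'E_P[fun w => (h_max^-1 * norm2 (projector c (x k w) *m grad f (x k w)) ^+ 2
                  + rho_min * norm1 (c (x k w)))%R]
    <= (A + K%:R * (beta * E + c2 * alpha / tau * (V + B)))%:E)%E.
  (* From here on the summand of index k belongs to step k.+1 of the algorithm. *)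
  rewrite big_add1/=.
  rewrite (eq_bigr (fun k => \int[P]_w (N k.+1 w)%:E)%E); last first.
    by move=> k _; rewrite unlock; under eq_integral do rewrite sqr_norm2.
  apply: le_trans (ge0_lower_integral_sum _ _ _) _.
    by move=> k w; rewrite lee_fin.
  under eq_integral do rewrite sumEFin.
  have iS : P.-integrable setT
      (EFin \o (fun w => A + \sum_(0 <= k < K) W k.+1 w)).
    by apply: integD; [exact: integ_cst|exact: integ_sum].
  apply: (@le_trans _ _ (\int[P]_w (A + \sum_(0 <= k < K) W k.+1 w)%:E)%E).
    apply: ge0_le_lower_integral => w; rewrite lee_fin ?path//.
    by apply: sumr_ge0.
  rewrite -[leLHS]fineK; last exact: integrable_fin_num.
  rewrite lee_fin -/(Rintegral P setT _) ExD ?integ_cst ?integ_sum// Ex_cst Ex_sum//.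
  rewrite lerD2l; apply: le_trans (ler_sum _ (fun k _ => EW k)) _.
  by rewrite sumr_const_nat subn0 mulr_natl.
have KR : 0 < K%:R :> R by rewrite ltr0n.
apply: le_trans (lee_wpmul2l _ EN) _; first by rewrite lee_fin invr_ge0 ltW.
rewrite -EFinM lee_fin le_eqVlt; apply/orP; left; apply/eqP.
rewrite /A /C /E /correlation_bound /B /momentum_bound /c2 /V.
have b1 : 0 < 1 - beta by rewrite subr_gt0.
clearbody tau.
by field; rewrite !gt_eqF.
Qed.
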